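(* Let $G$ be a 2-connected subcubic graph, $S\subseteq E(G)$, and $k$ a natural number. If $|S|\geq 2^{4k^2}$, then there exists a path $P$ in $G$ such that $|E(P)\cap S|\geq k$.
   Context: All graphs are finite and simple. A subcubic graph is a graph of maximum degree at most 3. *)

(* Defs.v *)
From mathcomp Require Import all_boot.

Set Implicit Arguments.
Unset Strict Implicit.
Unset Printing Implicit Defensive.

Record sgraph := SGraph {
  vertex :> finType;
  adj : rel vertex;
  adj_sym : symmetric adj;
  adj_irrefl : irreflexive adj
}.

(* An edge is the two-element set of its ends. *)
Definition edges (G : sgraph) : {set {set G}} :=
  [set e | [exists x, exists y, adj x y && (e == [set x; y])]].

Definition degree (G : sgraph) (x : G) : nat := #|[set y | adj x y]|.

Definition subcubic (G : sgraph) : Prop := forall x : G, degree x <= 3.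

Definition induced_adj (G : sgraph) (A : {set G}) : rel G :=
  [rel x y | [&& x \in A, y \in A & adj x y]].

Definition induced_connected (G : sgraph) (A : {set G}) : Prop :=
  {in A &, forall x y, connect (induced_adj A) x y}.

(* The usual definition: more than k vertices, and no set of fewer than k
   vertices disconnects G. In particular K_2 is not 2-connected. *)
Definition k_connected (k : nat) (G : sgraph) : Prop :=
  k < #|G| /\ forall X : {set G}, #|X| < k -> induced_connected (~: X).

(* The path with vertex sequence x :: p; it has no repeated vertices, and
   p = [::] gives the one-vertex path. *)
Definition is_path (G : sgraph) (x : G) (p : seq G) : Prop :=
  path (@adj G) x p /\ uniq (x :: p).

Definition path_edges (G : sgraph) (x : G) (p : seq G) : {set {set G}} :=
  [set e in pairmap (fun u v : G => [set u; v]) x p].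

(* Main.v *)
Require Import Defs.
From mathcomp Require Import all_boot zify.

Set Implicit Arguments.
Unset Strict Implicit.
Unset Printing Implicit Defensive.

(* Grow a path Q as a depth-first branch, at each vertex entering the component
   of the unvisited part that meets the most edges of S. As G is subcubic, at
   most one other component is left behind at each vertex, so that the number of
   edges of S is less than 2^m, where m counts the components left behind that
   meet an edge of S and the edges of S with both ends on Q. By 2-connectedness
   each such component contains the interior of an ear of Q through an edge of S,
   and the edges of S that are chords of Q are ears as well. Hence Q itself has
   k edges of S, or there are more than 4(k-1)^2 ears whose ends, by subcubicity,
   are distinct. View ears as intervals of Q: either k of them are nested, and a
   path zigzags through all of these, or more than 4(k-1) of them are pairwise
   not nested, and a quarter of these lie on a single path. *)

(** * Chains and antichains of a relation *)

(** Peeling off minimal elements: [M] collects the entries without an [R]-predecessor in [F]. If [M]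
    is small, induction gives a chain among the other entries, and its first element has a
    predecessor in [F] to put in front. *)
Lemma exists_chain_or_antichain (T : eqType) (R : rel T) (n m : nat) (F : seq T) :
  n * m < size F ->
  (exists c, [/\ size c = n.+1, sorted R c & {subset c <= F}]) \/
  (exists M, [/\ m < size M, subseq M F & {in M &, forall x y, ~~ R x y}]).
Proof.
elim: n F => [|n IHn] F ltF.
  by left; case: F ltF => // x F _; exists [:: x]; split=> // y; rewrite !inE => ->.
pose M := [seq x <- F | ~~ has (R^~ x) F].
have [ltmM|leMm] := ltnP m (size M).
  right; exists M; split=> //; first exact: filter_subseq.
  move=> x y; rewrite !mem_filter => /andP[_ Fx] /andP[/hasPn Ny _]; exact: Ny.
have ltF' : n * m < size [seq x <- F | has (R^~ x) F].
  have := count_predC (fun x => has (R^~ x) F) F.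
  rewrite -!size_filter; move: leMm; rewrite /M /=.
  rewrite (_ : [seq x <- F | predC _ x] = M) //; rewrite /M; lia.
have [[c [szc Rc sub]]|[M' [szM subM nR]]] := IHn _ ltF'; last first.
  by right; exists M'; split=> //; exact: subseq_trans subM (filter_subseq _ _).
left; case: c szc Rc sub => // x c szc Rc sub.
have /[!mem_filter]/andP[/hasP[y Fy Ryx] Fx] := sub x (mem_head _ _).
exists (y :: x :: c); split=> /=; [by case: szc => -> | by rewrite Ryx |].
move=> z; rewrite inE => /orP[/eqP-> //|/sub]; by rewrite mem_filter => /andP[].
Qed.

Lemma pairwise_or (T : eqType) (r : rel T) (s : seq T) x y :
  pairwise r s -> x \in s -> y \in s -> x != y -> r x y || r y x.
Proof.
move=> + + + xy; elim: s => //= z s IH /andP[/allP zs rs].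
rewrite !inE => /orP[/eqP xz|sx] /orP[/eqP yz|sy].
- by rewrite xz yz eqxx in xy.
- by rewrite xz zs.
- by rewrite yz [r z x]zs // orbT.
- exact: IH.
Qed.

(** * Edge sets of paths *)

Section PathEdges.
Variable G : sgraph.
Implicit Types (x y : G) (p : seq G) (e : {set G}).

Lemma path_edges_nil x : path_edges x [::] = set0.
Proof. by apply/setP=> e; rewrite !inE. Qed.

Lemma path_edges_cons x y p :
  path_edges x (y :: p) = [set x; y] |: path_edges y p.
Proof. by apply/setP=> e; rewrite !inE. Qed.

Lemma path_edges_cat x p1 p2 :
  path_edges x (p1 ++ p2) = path_edges x p1 :|: path_edges (last x p1) p2.
Proof.
elim: p1 x => [|y p1 IH] x /=; first by rewrite path_edges_nil set0U.
by rewrite !path_edges_cons IH setUA.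
Qed.

Lemma path_edges_rev x p :
  path_edges (last x p) (rev (belast x p)) = path_edges x p.
Proof.
elim: p x => [|y p IH] x //=.
rewrite rev_cons -cats1 path_edges_cat IH !path_edges_cons path_edges_nil setU0.
rewrite (_ : last _ _ = y) 1?[[set y; x]]setUC 1?setUC //.
by case: p {IH} => //= z p; rewrite rev_cons last_rcons.
Qed.

Lemma path_edges_sub x p e : e \in path_edges x p -> {subset e <= x :: p}.
Proof.
elim: p x => [|y p IH] x; first by rewrite path_edges_nil inE.
rewrite path_edges_cons in_setU1 => /orP[/eqP->|/IH sub] z.
  by rewrite !inE => /orP[]->; rewrite ?orbT.
by move/sub => pz; rewrite inE pz orbT.
Qed.

Lemma path_edges_meet x p e :
  e \in path_edges x p -> exists2 z, z \in p & z \in e.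
Proof.
elim: p x => [|y p IH] x; first by rewrite path_edges_nil inE.
rewrite path_edges_cons in_setU1 => /orP[/eqP->|/IH[z pz ez]].
  by exists y; rewrite !inE eqxx ?orbT.
by exists z; rewrite // inE pz orbT.
Qed.

Lemma rev_adj_path x p :
  path (@adj G) (last x p) (rev (belast x p)) = path (@adj G) x p.
Proof. by rewrite rev_path; apply: eq_path => u v; rewrite adj_sym. Qed.

Lemma rev_ear s d t :
  (path (@adj G) t (rcons (rev d) s) = path (@adj G) s (rcons d t)) *
  (path_edges t (rcons (rev d) s) = path_edges s (rcons d t)).
Proof.
rewrite -(rev_adj_path s) -(path_edges_rev s).
by rewrite last_rcons belast_rcons rev_cons.
Qed.

(** Every new edge has an end in [p2], hence off the first path, so no edge is counted twice. A gain
    of 0 or 1 is recorded, since an ear is only known to contain at least one edge of [S]. *)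
Lemma is_path_cat x p p2 (S : {set {set G}}) :
    is_path x p -> path (@adj G) (last x p) p2 -> uniq p2 ->
    {in p2, forall v, v \notin x :: p} ->
  is_path x (p ++ p2) /\
  #|path_edges x p :&: S| + (path_edges (last x p) p2 :&: S != set0)
    <= #|path_edges x (p ++ p2) :&: S|.
Proof.
move=> [pP pU] p2P p2U dis; split.
  split; first by rewrite cat_path pP.
  rewrite -cat_cons cat_uniq pU p2U andbT.
  by apply/hasPn => v /dis.
rewrite path_edges_cat setIUl cardsU [X in _ <= _ - X]eq_card0 ?subn0 => [|e].
  by rewrite leq_add2l -card_gt0; case: #|_|.
rewrite in_setI !(in_setI e); apply/negP => /andP[/andP[e1 _] /andP[e2 _]].
have [z p2z ez] := path_edges_meet e2.
by have := path_edges_sub e1 ez; rewrite (negPf (dis z p2z)).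
Qed.

End PathEdges.

(** * Ears through a given edge *)

Section Ears.
Variable G : sgraph.
Hypothesis conn2 : k_connected 2 G.

Lemma path_first_hit (e : rel G) (H : pred G) x p :
    path e x p -> uniq (x :: p) -> last x p \in H ->
  exists d t, [/\ rcons d t = x :: take (size d) p, t \in H & {in d, forall v, v \notin H}].
Proof.
elim: p x => [|y p IH] x /=; first by move=> _ _ Hx; exists [::], x.
have [Hx|nHx] := boolP (x \in H); first by exists [::], x; rewrite take0.
move=> /andP[_ yp] /andP[_ up] Hl.
have [d [t [dE Ht nH]]] := IH y yp up Hl.
exists (x :: d), t; split=> //=; first by rewrite dE.
by move=> v; rewrite inE => /orP[/eqP->|/nH].
Qed.

(** Deleting [z] leaves the graph connected, so some path from [w] to [h] avoids [z]; put [z] in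
    front and cut at the first vertex in [H]. The default in [head] covers an empty [d], where [t]
    is [w]. *)
Lemma exists_path_through_edge (H : pred G) z w h :
    adj z w -> h \in H -> h != z ->
  exists d t, [/\ path (@adj G) z (rcons d t), uniq (z :: rcons d t),
                  t \in H, {in d, forall v, v \notin H} & head t d = w].
Proof.
move=> zw Hh hz.
have wz : w != z by apply: contraTneq zw => ->; rewrite adj_irrefl.
have := (conn2.2 [set z]); rewrite cards1 => /(_ isT) /(_ w h).
rewrite !inE => /(_ wz hz) /connectP[p0 p0P hE]; subst h.
case/shortenP: p0P Hh hz => p pP pU _ Hh hz {p0}.
have [d [t [dE Ht nH]]] := path_first_hit pP pU Hh.
have pz : z \notin w :: p.
  rewrite inE negb_or eq_sym wz /=.
  elim: p (w) pP {pU Hh hz dE} => //= y p IH u /andP[/and3P[_ + _] /IH].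
  by rewrite !inE negb_or eq_sym => -> ->.
exists d, t; rewrite dE; split=> //.
- rewrite /= zw /=; apply: take_path.
  by apply: sub_path pP => u v /and3P[].
- rewrite cons_uniq -[_ :: take _ _]/(take (size d).+1 (w :: p)) take_uniq // andbT.
  by apply: contra pz => /mem_take.
by case: d dE {nH} => [|u d] /= [->].
Qed.

(** * Ears of [Q] with interior in a union [D] of components of the graph minus [Q] *)

Section Component.
Variables Q D : {set G}.
Hypothesis QD : [disjoint Q & D].
Hypothesis closedD : forall u v, u \in D -> adj u v -> (v \in D) || (v \in Q).

(** An empty [d] is allowed and gives a chord. As [Q] and [D] are disjoint, only the two ends lie on
    [Q]. *)
Definition ear_path s d t :=
  [/\ (s \in Q) && (t \in Q), s != t, path (@adj G) s (rcons d t),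
      uniq d & {subset d <= D}].

Lemma rev_ear_path s d t : ear_path s d t -> ear_path t (rev d) s.
Proof.
case=> /andP[sQ tQ] st pP du dD; split; rewrite ?sQ ?tQ ?rev_ear ?rev_uniq // 1?eq_sym //.
by move=> v; rewrite mem_rev => /dD.
Qed.

Lemma notin_QD v : v \in D -> v \in Q -> False.
Proof. by move=> vD vQ; have := disjointFr QD vQ; rewrite vD. Qed.

Lemma path_in_closed z d t :
    path (@adj G) z (rcons d t) -> z \in D -> {in d, forall v, v \notin Q} ->
  {subset d <= D}.
Proof.
elim: d z => //= y d IH z /andP[zy yP] zD nQ v.
have yD : y \in D.
  by have := closedD zD zy; rewrite (negPf (nQ y (mem_head _ _))) orbF.
rewrite inE => /orP[/eqP-> //|]; apply: IH yP yD _ _ => u du.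
by apply: nQ; rewrite inE du orbT.
Qed.

(** Follow the ear from [s] to [z] and turn into [f]. If [f] leads to a vertex of [Q] other than
    [s], this is a new ear; if it leads to the ear beyond [z], the rest of the old ear completes
    it. *)
Lemma reroute_ear s d1 z d2 t f h :
    ear_path s (d1 ++ z :: d2) t ->
    path (@adj G) z (rcons f h) -> uniq (z :: rcons f h) ->
    {in f, forall v, v \notin Q} -> {in f, forall v, v \notin d1 ++ z :: d2} ->
    (h \in Q) && (h != s) || (h \in d2) ->
  exists s' d t', ear_path s' d t' /\ [set z; head h f] \in path_edges s' (rcons d t').
Proof.
move=> [/andP[sQ tQ] st pP du dD] fP fU fQ fd hh.
have zD : z \in D by apply: dD; rewrite mem_cat inE eqxx orbT.
have fD := path_in_closed fP zD fQ.
move: pP; rewrite rcons_cat rcons_cons cat_path /= => /and3P[p1 p1z p2].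
case/orP: hh => [/andP[hQ hs]|hh].
  exists s, (d1 ++ z :: f), h; split; last first.
    rewrite rcons_cat path_edges_cat /= inE path_edges_cons inE.
    by case: (f) => [|y f'] /=; rewrite path_edges_cons !inE eqxx ?orbT.
  split=> //; [by rewrite sQ | by rewrite eq_sym | | |].
  - by rewrite rcons_cat cat_path p1 /= p1z.
  - move: du fU; rewrite !cat_uniq /= !negb_or rcons_uniq mem_rcons inE negb_or.
    move=> /and3P[-> /andP[-> _] _] /and3P[/andP[_ ->] _ ->]; rewrite !andbT /=.
    by apply/hasPn => v /fd; rewrite mem_cat negb_or => /andP[].
  - move=> v; rewrite mem_cat inE => /or3P[vd|/eqP->//|/fD//].
    by apply: dD; rewrite mem_cat vd.
have [e1 [e2 d2E]] : exists e1 e2, d2 = e1 ++ h :: e2.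
  by case/splitPr: hh => e1 e2; exists e1, e2.
move: p2 du fd dD; rewrite {}d2E rcons_cat /= cat_path => /and3P[_ _ p2] du fd dD.
exists s, (d1 ++ z :: f ++ h :: e2), t; split; last first.
  rewrite rcons_cat path_edges_cat /= inE path_edges_cons inE.
  by case: (f) => [|y f'] /=; rewrite path_edges_cons !inE eqxx ?orbT.
split=> //; first by rewrite sQ.
- rewrite rcons_cat cat_path p1 /= p1z /= rcons_cat /= -cat_rcons cat_path fP.
  by rewrite last_rcons.
- have perm : perm_eq (d1 ++ z :: f ++ h :: e2) (f ++ d1 ++ z :: h :: e2).
    by rewrite -cat_rcons -(cat_rcons z d1 (h :: e2)) perm_catCA.
  have sub : subseq (d1 ++ z :: h :: e2) (d1 ++ z :: e1 ++ h :: e2).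
    by rewrite cat_subseq //= eqxx suffix_subseq.
  rewrite (perm_uniq perm) cat_uniq (subseq_uniq sub du) andbT.
  move: fU; rewrite /= rcons_uniq => /and3P[_ _ ->] /=.
  by apply/hasPn => v /(mem_subseq sub) vd; apply/negP => /fd; rewrite vd.
- move=> v; rewrite mem_cat inE mem_cat => /or4P[vd|/eqP->//|/fD//|vh].
    by apply: dD; rewrite mem_cat vd.
  by apply: dD; rewrite mem_cat inE mem_cat vh !orbT.
Qed.

(** A path leaving [z] along the edge is cut where it first meets [Q] or the ear, and the ear is
    rerouted along it. If it arrives at [s] or on the ear before [z], the reversed ear is rerouted
    instead; at [s] this works because [s] and [t] differ. *)
Lemma ear_through_neighbor_edge s d t z w :
    ear_path s d t -> z \in d -> adj z w ->
  exists s' d' t', ear_path s' d' t' /\ [set z; w] \in path_edges s' (rcons d' t').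
Proof.
move=> E dz zw; have [/andP[sQ tQ] st _ _ dD] := E.
have nQz v : v \in Q -> v != z.
  by move=> vQ; apply/eqP=> vz; apply: (@notin_QD z); rewrite -?vz // vz dD.
pose H := [pred v | (v \in Q) || (v \in d)].
have Hs : s \in H by rewrite inE sQ.
have [f [h [fP fU Hh fH <-]]] := exists_path_through_edge zw Hs (nQz s sQ).
have fQ : {in f, forall v, v \notin Q} by move=> v /fH /norP[].
have fd : {in f, forall v, v \notin d} by move=> v /fH /norP[].
have hz : h != z.
  by move: fU; rewrite /= mem_rcons inE negb_or eq_sym => /andP[/andP[]].
have [d1 [d2 dE]] : exists d1 d2, d = d1 ++ z :: d2.
  by case/splitPr: dz => d1 d2; exists d1, d2.
rewrite inE /= in Hh; rewrite {}dE in E fd Hh.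
have E' := rev_ear_path E; rewrite rev_cat rev_cons cat_rcons in E'.
have fd' : {in f, forall v, v \notin rev d2 ++ z :: rev d1}.
  by move=> v /fd; rewrite !mem_cat !inE !mem_rev !negb_or => /and3P[-> -> ->].
case/orP: Hh => [hQ|].
  have [hs|hs] := eqVneq h s.
    by apply: (reroute_ear E' fP fU fQ fd'); rewrite hQ hs st.
  by apply: (reroute_ear E fP fU fQ fd); rewrite hQ hs.
rewrite mem_cat inE (negPf hz) => /orP[hd|/= hd].
  by apply: (reroute_ear E' fP fU fQ fd'); rewrite mem_rev hd orbT.
by apply: (reroute_ear E fP fU fQ fd); rewrite hd orbT.
Qed.

(** Induction along a path from [z] to [Q]; an ear through the vertex [z] is enough. If the next
    vertex [y] lies in [D], induction gives an ear through the edge from [y] to [z]. If it lies in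
    [Q], a path that leaves [y] through [z] and returns to [Q] elsewhere is one. *)
Lemma exists_ear_through_edge z w :
    1 < #|Q| -> z \in D -> adj z w ->
  exists s d t, ear_path s d t /\ [set z; w] \in path_edges s (rcons d t).
Proof.
move=> Q2 zD zw; have [r rQ] : exists r, r \in Q by apply/card_gt0P; lia.
have := conn2.2 set0; rewrite cards0 => /(_ isT) /(_ z r).
rewrite !inE => /(_ isT isT) /connectP[p pP rE].
have {}pP : path (@adj G) z p by apply: sub_path pP => u v /and3P[].
rewrite {r}rE in rQ; elim: p z zD w zw pP rQ => /= [|y p IH] z zD w zw.
  by move=> _ /(notin_QD zD).
move=> /andP[zy yP] lQ.
suff [s [d [t [E zd]]]] : exists s d t, ear_path s d t /\ z \in d.
  exact: ear_through_neighbor_edge E zd zw.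
have [yD|yQ] := orP (closedD zD zy).
  have [s [d [t [E /path_edges_sub sub]]]] := IH y yD z (etrans (adj_sym _ _) zy) yP lQ.
  exists s, d, t; split=> //; have := sub z; rewrite !inE eqxx orbT => /(_ isT).
  have [/andP[sQ tQ] _ _ _ _] := E.
  rewrite mem_rcons inE => /or3P[/eqP zs|/eqP zt|//].
    by case: (@notin_QD z); rewrite // zs.
  by case: (@notin_QD z); rewrite // zt.
have [h hQ hy] : exists2 h, h \in Q & h != y.
  have : 0 < #|Q :\ y| by have := cardsD1 y Q; rewrite yQ; lia.
  by case/card_gt0P => h; rewrite !inE => /andP[]; exists h.
have yz : adj y z by rewrite adj_sym.
have [d [t [dP dU tQ dQ dz]]] := @exists_path_through_edge (mem Q) y z h yz hQ hy.
have zd : z \in d.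
  case: d dz {dP dU dQ} => [/= tz|u d /= ->]; last exact: mem_head.
  by case: (@notin_QD z); rewrite // -tz.
exists y, d, t; split=> //; move: dU; rewrite /= mem_rcons inE negb_or rcons_uniq.
move=> /and3P[/andP[yt _] _ du]; split; rewrite // ?yQ //.
case: d dz dP dQ {du zd} => //= u d -> /andP[_ zP] dQ v.
rewrite inE => /orP[/eqP->//|]; apply: path_in_closed zP zD _ _ => x dx.
by apply: dQ; rewrite inE dx orbT.
Qed.

End Component.
End Ears.

(** * The heavy branch *)

Section Descent.
Variable G : sgraph.
Hypothesis cubic : subcubic G.
Variable S : {set {set G}}.
Hypothesis SE : S \subset edges G.

Lemma edge_at e z : e \in S -> z \in e -> exists2 v, adj z v & e = [set z; v].
Proof.
move=> /(subsetP SE); rewrite inE => /existsP[x /existsP[y /andP[xy /eqP->]]].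
rewrite !inE => /orP[]/eqP->; first by exists y.
by exists x; rewrite 1?adj_sym // setUC.
Qed.

Definition touching (C : {set G}) := [set e in S | ~~ [disjoint e & C]].
Definition inside (q : seq G) := [set e in S | e \subset q].

Lemma touchingP (C : {set G}) e :
  reflect (e \in S /\ exists2 z, z \in e & z \in C) (e \in touching C).
Proof.
rewrite inE; apply: (iffP andP) => -[eS]; first by case/pred0Pn=> z /andP[]; split=> //; exists z.
by case=> z ez Cz; split=> //; apply/pred0Pn; exists z; rewrite /= ez.
Qed.

Lemma touchingS (C C' : {set G}) : C \subset C' -> touching C \subset touching C'.
Proof.
move=> sCC; apply/subsetP=> e /touchingP[eS [z ez Cz]]; apply/touchingP; split=> //.
by exists z; rewrite // (subsetP sCC).
Qed.

(** When [C] avoids [q], this makes [C] a union of components of the graph minus [q]. *)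
Definition closed_off (q : seq G) (C : {set G}) :=
  forall u v, u \in C -> adj u v -> (v \in C) || (v \in q).

Definition component (C : {set G}) (a : G) : {set G} :=
  [set z | connect (induced_adj C) a z].

Lemma component_sub (C : {set G}) a : a \in C -> component C a \subset C.
Proof.
move=> Ca; apply/subsetP => z; rewrite inE => /connectP[p].
elim: p a Ca => [|y p IH] a Ca /=; first by move=> _ ->.
by move=> /andP[/and3P[_ Cy _]]; exact: IH.
Qed.

Lemma connect_component (C : {set G}) a z :
  z \in component C a -> connect (induced_adj (component C a)) a z.
Proof.
rewrite inE => /connectP[p pP ->].
suff sub : {subset a :: p <= component C a}.
  apply/connectP; exists p => //; move: sub; set X := component C a => sub.
  elim: p (a) pP sub => //= y p IH b /andP[/and3P[_ _ bY] yP] sub.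
  rewrite IH // ?andbT; last by move=> u yu; apply: sub; rewrite inE yu orbT.
  by rewrite /induced_adj /= bY !sub // !inE eqxx ?orbT.
move=> u pu; case/splitPl: pu pP => p1 p2 <-; rewrite cat_path inE => /andP[p1P _].
by apply/connectP; exists p1.
Qed.

(** A path from [w] without repetition never returns to [w], so after its first step it stays in one
    component of [C :\ w]. *)
Lemma component_nbr (C : {set G}) w z :
    connect (induced_adj C) w z -> z != w ->
  exists2 a, a \in C :\ w & adj w a /\ z \in component (C :\ w) a.
Proof.
move=> /connectP[p0 p0P ->]; case/shortenP: p0P => p pP pU _ {p0}.
case: p pP pU => [|a p] /=; first by rewrite eqxx.
move=> /andP[/and3P[Cw Ca wa] pP] /andP[+ pU] _.
rewrite inE negb_or => /andP[aw wp]; exists a; first by rewrite !inE eq_sym aw.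
split=> //; rewrite inE; apply/connectP; exists p => //.
elim: p a pP wp aw {Ca wa pU} => //= y p IH a /andP[/and3P[Ca Cy ay] yP].
rewrite inE negb_or => /andP[wy wp] aw.
by rewrite /induced_adj /= !inE ![_ == w]eq_sym wy aw Ca Cy ay; exact: IH.
Qed.

(** Lets an additive loss of [j] edges be absorbed by adding [j] to the exponent. *)
Lemma leq_add_mul_exp2 x j : 0 < x -> x + j <= x * 2 ^ j.
Proof.
move=> x0; elim: j => [|j IH]; first by rewrite addn0 muln1.
by rewrite expnS; nia.
Qed.

(* A depth-first branch through C, always continued into the component with the
   most edges of S: abandoning the other one costs a factor 2, and every edge of
   S with both ends on the branch costs 1. *)
Lemma heavy_branch (C : {set G}) x p w :
    is_path x p -> {in C, forall z, z \notin x :: p} ->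
    closed_off (x :: p) C -> w \in C -> adj (last x p) w ->
    {in C, forall z, connect (induced_adj C) w z} ->
  exists p' (Ds : seq {set G}),
    [/\ is_path x (p ++ p'), p' != [::], {subset p' <= C},
        pairwise (fun D D' : {set G} => [disjoint D & D']) Ds /\
        {in Ds, forall D : {set G}, [/\ D \subset C, {in D, forall z, z \notin p'},
           closed_off (x :: p ++ p') D & touching D != set0]}
      & #|touching C| < 2 ^ (size Ds + #|touching C :&: inside (x :: p ++ p')|)].
Proof.
have [n] := ubnP #|C|; elim: n C x p w => // n IH C x p w ltC pP Cp Cc Cw lw Cconn.
have pwP : is_path x (rcons p w).
  case: pP => pP pU; split; first by rewrite rcons_path pP.
  by rewrite -rcons_cons rcons_uniq pU Cp.
pose T := [set z in C :\ w | adj w z].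
(* One of the at most three neighbours of [w] is its predecessor on the path, which lies outside
   [C]. *)
have T2 : #|T| <= 2.
  have := cubic w; rewrite /degree.
  have sub : last x p |: T \subset [set y | adj w y].
    by apply/subsetP => y; rewrite !inE => /orP[/eqP->|/andP[]//]; rewrite adj_sym.
  have := subset_leq_card sub; rewrite cardsU1 !inE.
  have -> : last x p \in C = false by apply: contraTF (mem_last x p) => /Cp.
  by rewrite andbF /=; lia.
pose A a := component (C :\ w) a.
have inT z : z \in C :\ w -> exists2 a, a \in T & z \in A a.
  rewrite 2!inE => /andP[zw Cz]; have [a Ca [wa za]] := component_nbr (Cconn z Cz) zw.
  by exists a; rewrite // inE Ca.
(* As [C] avoids the old path, these are the edges of [S] joining [w] to it. *)
pose J := touching C :&: inside (x :: rcons p w).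
(* An edge that touches [C] but not [B] has [w] as its only end in [C]; its other end is then on the
   path, because [C] is closed off. *)
have touchD (B : {set G}) e : e \in touching C -> C :\ w \subset B ->
    (e \in touching B) || (e \in J).
  move=> eC sB; have [eS [z ez Cz]] := touchingP _ _ eC.
  have [eB|eB] := boolP (e \in touching B) => //=; rewrite inE eC inE eS /=.
  have nB v : v \in e -> v \notin B.
    by move=> ev; apply: contra eB => Bv; apply/touchingP; split=> //; exists v.
  have zw : z = w.
    by apply/eqP; apply: contraR (nB z ez) => zw; rewrite (subsetP sB) // !inE zw.
  have [v wv eE] := edge_at eS ez; rewrite zw in wv eE.
  apply/subsetP => u; rewrite eE => /set2P[]->; rewrite inE mem_rcons inE ?eqxx ?orbT //.
  have ev : v \in e by rewrite eE !inE eqxx orbT.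
  have vw : v != w by apply: contraTneq wv => ->; rewrite adj_irrefl.
  have /orP[Cv|] := Cc w v Cw wv; last by rewrite inE => /orP[]->; rewrite ?orbT.
  by have := nB v ev; rewrite (subsetP sB) // !inE vw.
(* If [w] has no neighbour in [C], then [C] is just [w] by connectedness, and the branch ends
   here. *)
have [T0|[a0 Ta0]] := set_0Vmem T.
  have C0 : C :\ w = set0.
    by apply/setP => z; rewrite in_set0; apply/negP => /inT[a]; rewrite T0 inE.
  exists [:: w], [::]; split=> //.
  - by rewrite cats1.
  - by move=> z; rewrite inE => /eqP->.
  apply: leq_trans (ltn_expl _ (ltnSn 1)) _; rewrite leq_exp2l // add0n.
  apply: subset_leq_card; apply/subsetP => e eC.
  have := touchD set0 e eC; rewrite C0 subxx cats1 => /(_ isT) /orP[|//].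
  by case/touchingP => _ [z _]; rewrite inE.
have [a Ta maxa] : exists2 a, a \in T & forall b, b \in T -> #|touching (A b)| <= #|touching (A a)|.
  by case: (@arg_maxnP _ a0 [in T] (fun b => #|touching (A b)|) Ta0) => a Ta ma; exists a.
have [Ca wa] : a \in C :\ w /\ adj w a by move: Ta; rewrite inE => /andP.
have sAC : A a \subset C :\ w by exact: component_sub.
have sAC' : A a \subset C by apply: subset_trans sAC (subD1set _ _).
(* What is left behind at [w]. As [T] has at most two elements, [D] lies in the component of a
   single other neighbour, so it touches no more edges of [S] than the component entered. *)
pose D := (C :\ w) :\: A a.
have ltA : #|A a| < n.
  by rewrite -ltnS (leq_trans _ ltC) // ltnS (cardsD1 w C) Cw ltnS subset_leq_card.
have Ap : {in A a, forall z, z \notin x :: rcons p w}.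
  move=> z /(subsetP sAC); rewrite !inE mem_rcons inE => /andP[zw /Cp].
  by rewrite inE (negPf zw).
have Acl : closed_off (x :: rcons p w) (A a).
  move=> u v Au uv; have Cu := subsetP sAC _ Au.
  have := Cc u v (subsetP sAC' _ Au) uv; rewrite !inE mem_rcons inE.
  have [vw|vw] := eqVneq v w; first by rewrite !orbT.
  case/orP => [Cv|->]; last by rewrite orbT.
  rewrite /A inE in Au; rewrite (connect_trans Au) //.
  by apply: connect1; rewrite /induced_adj /= Cu uv !inE vw Cv.
have [||p' [Ds [p'P _ sp' [dD pD] cnt]]] :=
  IH (A a) x (rcons p w) a ltA pwP Ap Acl _ _ (@connect_component _ _).
  - by rewrite inE connect0.
  - by rewrite last_rcons.
have catE : x :: p ++ w :: p' = x :: rcons p w ++ p' by rewrite cat_rcons.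
have sDC : D \subset C by apply: subset_trans (subsetDl _ _) (subD1set _ _).
have Dp' z : z \in D -> z \notin w :: p'.
  rewrite /D !inE => /and3P[nA zw Cz]; rewrite negb_or zw; apply: contra nA => /sp'.
  by rewrite /A inE.
have Dcl : closed_off (x :: p ++ w :: p') D.
  move=> u v Du uv; have Cu := subsetP sDC _ Du.
  move: (Du); rewrite /D !inE => /and3P[nAu uw _].
  have := Cc u v Cu uv; rewrite !in_cons mem_cat in_cons.
  have [vw|vw] := eqVneq v w; first by rewrite !orbT.
  case/orP => [Cv|/orP[]->]; rewrite ?orbT //.
  rewrite Cv !andbT; apply/orP; left; apply: contra nAu => Au.
  apply: connect_trans Au _; apply: connect1.
  by rewrite /induced_adj /= !inE vw uw Cv Cu adj_sym.
have leD : #|touching D| <= #|touching (A a)|.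
  have [D0|[z Dz]] := set_0Vmem D.
    rewrite (_ : touching D = set0) ?cards0 //; apply/setP => e; rewrite in_set0.
    by apply/negP => /touchingP[_ [z _]]; rewrite D0 inE.
  have inTa u : u \in D -> exists2 b, b \in T :\ a & u \in A b.
    rewrite in_setD => /andP[nA /inT[b Tb Ab]]; exists b => //.
    by rewrite in_setD1 Tb andbT; apply: contraNneq nA => <-.
  have [b Tb Ab] := inTa z Dz.
  apply: leq_trans (maxa b _); last by move: Tb; rewrite in_setD1 => /andP[].
  apply: subset_leq_card; apply: touchingS; apply/subsetP => u /inTa[c Tc].
  have le1 : #|T :\ a| <= 1 by rewrite -ltnS (leq_trans _ T2) // [leqRHS](cardsD1 a) Ta.
  by rewrite (card_le1_eqP le1 c b Tc Tb).
have cntC : #|touching C| <= #|touching (A a)| + #|touching D| + #|J|.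
  have sub : touching C \subset touching (A a) :|: touching D :|: J.
    apply/subsetP => e eC; have := touchD _ e eC (subxx _); rewrite !in_setU => /orP[|->].
      case/touchingP=> eS [z ez Cz]; apply/orP; left; apply/orP.
      have [Az|nAz] := boolP (z \in A a); [left|right]; apply/touchingP; split=> //; exists z => //.
      by rewrite inE nAz.
    by rewrite orbT.
  apply: leq_trans (subset_leq_card sub) _.
  rewrite (leq_trans (leq_card_setU _ _)) // leq_add2r.
  exact: leq_card_setU.
set n1 := #|_ :&: _| in cnt.
(* The two sets are disjoint: an edge counted by [n1] has an end in [A a], off the path up to [w],
   whereas an edge of [J] has both ends on it. *)
have cntJ : n1 + #|J| <= #|touching C :&: inside (x :: p ++ w :: p')|.
  pose I1 := touching (A a) :&: inside (x :: rcons p w ++ p').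
  rewrite -[n1 + _]subn0 -(@eq_card0 _ [in I1 :&: J]).
    rewrite -cardsU; apply: subset_leq_card; rewrite subUset; apply/andP; split.
      by rewrite catE setSI // touchingS.
    apply/subsetP => e; rewrite !in_setI => /andP[->]; rewrite !inE catE => /andP[->] /subsetP sub.
    by apply/subsetP => v /sub vp; rewrite -cat_cons mem_cat vp.
  move=> e; apply/negP; rewrite !in_setI => /andP[/andP[/touchingP[_ [z ez Az]] _] /andP[_]].
  rewrite inE => /andP[_ /subsetP /(_ z ez)]; exact/negP/Ap.
have pow := leq_add_mul_exp2 #|J| (expn_gt0 2 (size Ds + n1)).
have sp2 : {subset w :: p' <= C}.
  by move=> z; rewrite inE => /orP[/eqP->//|/sp' /(subsetP sAC')].
have pD2 D' : D' \in Ds -> [/\ D' \subset C, {in D', forall z, z \notin w :: p'},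
    closed_off (x :: p ++ w :: p') D' & touching D' != set0].
  move=> /pD[s1 s2 s3 s4]; split=> //; last by rewrite catE.
    exact: subset_trans sAC'.
  move=> z Dz; rewrite inE negb_or s2 // andbT.
  by have := subsetP (subset_trans s1 sAC) z Dz; rewrite !inE => /andP[].
have pw2 : is_path x (p ++ w :: p') by rewrite -cat_rcons.
(* If [D] touches no edge of [S] it is not recorded, and no factor 2 is lost; otherwise [D] joins
   the list and pays for the doubling. *)
have [D0|D0] := eqVneq (touching D) set0.
  exists (w :: p'), Ds; split=> //.
  apply: leq_ltn_trans cntC _; rewrite D0 cards0 addn0.
  apply: (@leq_trans (2 ^ (size Ds + n1 + #|J|))).
    by rewrite expnD; move: cnt pow; clear; lia.
  by rewrite leq_exp2l // -addnA leq_add2l.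
exists (w :: p'), (D :: Ds); split=> //.
  split=> [/=|D']; last by rewrite inE => /orP[/eqP->|/pD2//].
  rewrite dD andbT; apply/allP => D' /pD[s1 _ _ _].
  rewrite disjoint_sym; apply: disjointWl s1 _; rewrite -setI_eq0.
  by apply/eqP/setP => z; rewrite !inE; case: (connect _ _ _).
apply: leq_ltn_trans cntC _.
apply: (@leq_trans (2 ^ (1 + (size Ds + n1) + #|J|))).
  by rewrite -addnA expnS expnD; move: cnt leD pow; clear; lia.
by rewrite leq_exp2l // -!addnA [size (D :: Ds)]/= add1n addSn ltnS leq_add2l.
Qed.
End Descent.

(** * Zigzagging through ears *)

Section Zigzag.
Variables (G : sgraph) (S : {set {set G}}) (x0 : G) (p0 : seq G).
Hypothesis p0P : is_path x0 p0.
Let Q := x0 :: p0.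
Let q i := nth x0 Q i.

(* (i, j, d) is the path from the i-th to the j-th vertex of Q with interior d. *)
Notation ear := (nat * nat * seq G)%type.
Definition lo (E : ear) := E.1.1.
Definition hi (E : ear) := E.1.2.
Definition mid (E : ear) := E.2.

Definition is_ear (E : ear) :=
  [/\ lo E < hi E < size Q, path (@adj G) (q (lo E)) (rcons (mid E) (q (hi E))),
      uniq (mid E), {in mid E, forall v, v \notin Q}
    & path_edges (q (lo E)) (rcons (mid E) (q (hi E))) :&: S != set0].

(* A and L record what is still available for prolonging the path: positions
   on Q and ears. *)
Definition reaches (n i : nat) (A : pred nat) (L : seq ear) :=
  exists x p, [/\ is_path x p, last x p = q i, n <= #|path_edges x p :&: S|,
    forall l, l < size Q -> A l -> q l \notin x :: p
    & forall E v, E \in L -> v \in mid E -> v \notin x :: p].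

Lemma reaches_path n i A L : reaches n i A L ->
  exists x p, is_path x p /\ n <= #|path_edges x p :&: S|.
Proof. by case=> x [p [pP _ nS _ _]]; exists x, p. Qed.

Lemma reaches_sub n i (A A' : pred nat) (L L' : seq ear) :
  reaches n i A L -> (forall l, A' l -> A l) -> {subset L' <= L} -> reaches n i A' L'.
Proof.
case=> x [p [pP pl nS nA nL]] sA sL; exists x, p; split=> //.
  by move=> l ls Al; apply: nA => //; exact: sA.
by move=> E v /sL; exact: nL.
Qed.

Lemma q_inj i j : i < size Q -> j < size Q -> (q i == q j) = (i == j).
Proof. by move=> *; rewrite nth_uniq //; case: p0P. Qed.

Lemma adj_q i : i.+1 < size Q -> adj (q i) (q i.+1).
Proof. by case: p0P => /(pathP x0) pP _ lt; apply: pP. Qed.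

Lemma reaches_start i (L : seq ear) : i < size Q ->
  {in L, forall E, is_ear E} -> reaches 0 i (predC1 i) L.
Proof.
move=> ltiQ okL; exists (q i), [::]; split=> //.
  by move=> l lt; rewrite !inE q_inj.
by move=> E v /okL[_ _ _ + _] => /[apply]; apply: contra; rewrite inE => /eqP->; exact: mem_nth.
Qed.

Lemma reaches_step n i j (A : pred nat) L :
    reaches n i A L -> adj (q i) (q j) -> j < size Q -> A j ->
    {in L, forall E, is_ear E} ->
  reaches n j [pred l | A l && (l != j)] L.
Proof.
case=> x [p [pP pl nS nA nL]] ij lt Aj okL.
have [|//||rP rS] := @is_path_cat G x p [:: q j] S pP.
- by rewrite pl /= ij.
- by move=> v; rewrite inE => /eqP->; apply: nA.
exists x, (p ++ [:: q j]); rewrite last_cat; split=> //.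
- by apply: leq_trans rS; apply: leq_trans nS (leq_addr _ _).
- move=> l ltl /andP[/(nA l ltl) nl lj].
  by rewrite -cat_cons mem_cat (negPf nl) inE q_inj.
- move=> E v LE Ev; rewrite -cat_cons mem_cat (negPf (nL _ _ LE Ev)) inE.
  have [_ _ _ /(_ v Ev) + _] := okL E LE.
  by apply: contra => /eqP->; exact: mem_nth.
Qed.

(** Steps along [Q] in either direction, using up every position passed. Edges of [S] on [Q] are not
    credited; only ears raise [n]. *)
Lemma reaches_walk n i j (A A' : pred nat) L :
    reaches n i A L -> i < size Q -> j < size Q ->
    (forall l, minn i j <= l <= maxn i j -> l != i -> A l) ->
    (forall l, A' l -> A l && ~~ (minn i j <= l <= maxn i j)) ->
    {in L, forall E, is_ear E} ->
  reaches n j A' L.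
Proof.
move=> iR iQ jQ segA sA' okL; have [m] := ubnP (maxn i j - minn i j).
elim: m i A iR iQ segA sA' => // m IH i A iR iQ segA sA' lem.
have [ij|ij] := eqVneq i j.
  by rewrite -ij; apply: reaches_sub iR _ _ => // l /sA' /andP[].
pose i' := if i < j then i.+1 else i.-1.
have i'E : (i < j) && (i' == i.+1) || (j < i) && (i == i'.+1) by rewrite /i'; case: ifP => ?; lia.
have i'Q : i' < size Q by lia.
have ii' : adj (q i) (q i').
  case/orP: i'E => /andP[_ /eqP E].
    by rewrite E adj_q // -E.
  by rewrite adj_sym E adj_q // -E.
have Ai' : A i' by apply: segA; lia.
apply: (IH i' _ (reaches_step iR ii' i'Q Ai' okL)) => //; last by lia.
  by move=> l l1 l2; rewrite /= segA; lia.
by move=> l /sA' /=; have := Ai'; case: (A l) => //=; lia.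
Qed.

Lemma reaches_cross n E i j (A A' : pred nat) L L' :
    reaches n i A L -> is_ear E -> E \in L ->
    (i == lo E) && (j == hi E) || (i == hi E) && (j == lo E) -> A j ->
    (forall l, A' l -> A l && (l != j)) ->
    (forall E', E' \in L' -> [/\ E' \in L, is_ear E' & {in mid E, forall v, v \notin mid E'}]) ->
  reaches n.+1 j A' L'.
Proof.
case=> x [p [pP pl nS nA nL]] okE LE ijE Aj sA sL.
have [/andP[lohi hiQ] eP eU eQ eS] := okE.
have jQ : j < size Q by lia.
pose d := if i == lo E then mid E else rev (mid E).
have memd v : (v \in d) = (v \in mid E) by rewrite /d; case: ifP; rewrite ?mem_rev.
have [dP dU dS] : [/\ path (@adj G) (q i) (rcons d (q j)), uniq d
    & path_edges (q i) (rcons d (q j)) :&: S != set0].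
  rewrite /d; case/orP: ijE => /andP[/eqP-> /eqP->]; first by rewrite eqxx.
  have -> : (hi E == lo E) = false by lia.
  by rewrite !rev_ear rev_uniq.
have [|||rP rS] := @is_path_cat G x p (rcons d (q j)) S pP.
- by rewrite pl.
- rewrite rcons_uniq dU memd andbT; apply/negP => /eQ.
  by rewrite mem_nth.
- move=> v; rewrite mem_rcons inE memd => /orP[/eqP->|]; first exact: nA.
  exact: nL.
exists x, (p ++ rcons d (q j)); rewrite last_cat last_rcons; split=> //.
- by apply: leq_trans rS; rewrite pl dS addn1.
- move=> l lQ /sA /andP[Al lj]; rewrite -cat_cons mem_cat (negPf (nA l lQ Al)) mem_rcons inE.
  rewrite q_inj // (negPf lj) memd /=; apply/negP => /eQ.
  by rewrite mem_nth.
- move=> E' v /sL[LE' [_ _ _ /(_ v) E'Q _] dis] Ev.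
  rewrite -cat_cons mem_cat (negPf (nL _ _ LE' Ev)) mem_rcons inE memd /= negb_or.
  apply/andP; split; first by apply: contraNneq (E'Q Ev) => ->; exact: mem_nth.
  by apply: contraL Ev => /dis.
Qed.

(** The basic move of every zigzag: walk along [Q] to one end [h] of an ear, then cross the ear to
    its other end [j], gaining one edge of [S]. *)
Lemma reaches_hop n i h j E (A A' : pred nat) L L' :
    reaches n i A L -> i < size Q ->
    {in L, forall E', is_ear E'} -> E \in L -> {subset L' <= L} ->
    {in L', forall E', {in mid E, forall v, v \notin mid E'}} ->
    (h == lo E) && (j == hi E) || (h == hi E) && (j == lo E) ->
    (forall l, minn i h <= l <= maxn i h -> l != i -> A l) ->
    A j -> ~~ (minn i h <= j <= maxn i h) ->
    (forall l, A' l -> [&& A l, ~~ (minn i h <= l <= maxn i h) & l != j]) ->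
  reaches n.+1 j A' L'.
Proof.
move=> iR iQ okL LE sL dis hj seg Aj nj sA.
have [/andP[lohi hiQ] _ _ _ _] := okL E LE.
have hQ : h < size Q by lia.
have hR : reaches n h [pred l | A l && ~~ (minn i h <= l <= maxn i h)] L.
  exact: reaches_walk iR iQ hQ seg _ okL.
apply: (reaches_cross hR (okL E LE) LE hj).
- by rewrite /= Aj.
- by move=> l /sA /and3P[Al nl lj]; rewrite /= Al nl lj.
- by move=> E' LE'; split; [exact: sL | exact/okL/sL | exact: dis].
Qed.

Definition nested : rel ear := [rel E E' | (lo E < lo E') && (hi E' < hi E)].
(** Covers both crossing intervals and disjoint ones: for ears with four distinct ends it is, up to
    order, the alternative to [nested]. *)
Definition precedes : rel ear := [rel E E' | (lo E < lo E') && (hi E < hi E')].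

Lemma nested_trans : transitive nested.
Proof.
move=> E1 E2 E3 /andP[h1 h2] /andP[h3 h4]; apply/andP.
by split; [exact: ltn_trans h3 | exact: ltn_trans h2].
Qed.

Lemma precedes_trans : transitive precedes.
Proof.
move=> E1 E2 E3 /andP[h1 h2] /andP[h3 h4]; apply/andP.
by split; [exact: ltn_trans h3 | exact: ltn_trans h4].
Qed.

(** * Zigzags through families of ears with disjoint interiors *)

Variable F : seq ear.
Hypothesis okF : {in F, forall E, is_ear E}.
Hypothesis disF : {in F &, forall E E', E != E' -> {in mid E, forall v, v \notin mid E'}}.

Lemma disF_lo (E : ear) (L : seq ear) : E \in F -> {subset L <= F} ->
  {in L, forall E', lo E < lo E'} -> {in L, forall E', {in mid E, forall v, v \notin mid E'}}.
Proof.
move=> FE LF Llo E' LE'; apply: disF; rewrite // ?LF //.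
by apply: contraTneq (Llo E' LE') => ->; rewrite ltnn.
Qed.

(** The path stands at one end of [E] with all positions strictly inside [E] still free. Walk
    inwards to the end of [E'] on the same side and cross [E'] to the opposite side; then the inside
    of [E'] is free. *)
Lemma nested_zigzag c E n i :
    E \in F -> {subset c <= F} -> path nested E c ->
    (i == lo E) || (i == hi E) -> reaches n i (fun l => lo E < l < hi E) c ->
  exists x p, is_path x p /\ n + size c <= #|path_edges x p :&: S|.
Proof.
elim: c E n i => [|E' c IH] E n i FE cF /=; first by move=> _ _ /reaches_path; rewrite addn0.
move=> /andP[/andP[EE' EE''] E'c] iE iR.
have FE' : E' \in F by apply: cF; exact: mem_head.
have cF' : {subset c <= F} by move=> D cD; apply: cF; rewrite inE cD orbT.
have [/andP[lohi hiQ] _ _ _ _] := okF FE.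
have [/andP[lohi' hiQ'] _ _ _ _] := okF FE'.
have cdis := @disF_lo E' c FE' cF'.
have {}cdis : {in c, forall D, {in mid E', forall v, v \notin mid D}}.
  by apply: cdis => D; move: (order_path_min nested_trans E'c) => /allP /[apply] /andP[].
pose h := if i == lo E then lo E' else hi E'.
pose j := if i == lo E then hi E' else lo E'.
have hE : (i == lo E) && (h == lo E') && (j == hi E') ||
    (i == hi E) && (h == hi E') && (j == lo E').
  by move: iE; rewrite /h /j; case: ifP => /= ?; lia.
rewrite addnS -addSn; apply: (IH E' n.+1 j) => //; first by lia.
apply: (@reaches_hop n i h j E' _ _ _ _ iR) => //; try lia.
- by move=> D /cF; exact: okF.
- exact: mem_head.
- by move=> D cD; rewrite inE cD orbT.
Qed.

(* Consecutive pairs of ears lead from one right end to the next; a last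
   unpaired ear is dropped. *)
Lemma crossing_zigzag c L E B n :
    E \in F -> {subset c ++ L <= F} -> path precedes E c ->
    B <= hi E -> {in c, forall D, lo D < B} ->
    {in c & L, forall D D', lo D < lo D'} ->
    reaches n (hi E) (fun l => (lo E < l < B) || (hi E < l)) (c ++ L) ->
  exists2 X, X \in E :: c & reaches (n + (size c)./2.*2) (hi X) (fun l => hi X < l) L.
Proof.
have [m] := ubnP (size c); elim: m c E n => // m IH c E n lec FE cLF.
case: c lec cLF => [|E1 [|E2 c]] lec cLF Ec BE cB cL ER.
- exists E; rewrite ?mem_head // addn0; apply: reaches_sub ER _ _ => // l /=.
  by move=> ltl; rewrite ltl orbT.
- exists E; rewrite ?mem_head // addn0; apply: reaches_sub ER _ _ => [l|D].
    by move=> ltl; rewrite ltl orbT.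
  by move=> LD; rewrite inE LD orbT.
have FE1 : E1 \in F by apply: cLF; rewrite inE eqxx.
have FE2 : E2 \in F by apply: cLF; rewrite !inE eqxx !orbT.
have cLF1 : {subset E2 :: c ++ L <= F} by move=> D cD; apply: cLF; rewrite inE cD orbT.
have cLF2 : {subset c ++ L <= F} by move=> D cD; apply: cLF1; rewrite inE cD orbT.
have okL : {in E1 :: E2 :: c ++ L, forall D, is_ear D} by move=> D /cLF; exact: okF.
have [/andP[lohi hiQ] _ _ _ _] := okF FE.
have [/andP[lohi1 hiQ1] _ _ _ _] := okF FE1.
have [/andP[lohi2 hiQ2] _ _ _ _] := okF FE2.
have B1 := cB E1 (mem_head _ _).
have B2 : lo E2 < B by apply: cB; rewrite !inE eqxx orbT.
move: Ec => /= /and3P[/andP[l1 h1] /andP[l2 h2] pc].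
have cmin D : D \in c -> lo E2 < lo D.
  by move: (order_path_min precedes_trans pc) => /allP /[apply] /andP[].
have dis2 : {in c ++ L, forall D, {in mid E2, forall v, v \notin mid D}}.
  apply: disF_lo => // D; rewrite mem_cat => /orP[/cmin//|DL].
  by apply: cL => //; rewrite !inE eqxx orbT.
have dis1 : {in E2 :: c ++ L, forall D, {in mid E1, forall v, v \notin mid D}}.
  apply: disF_lo => // D; rewrite inE mem_cat => /or3P[/eqP->//|/cmin ltD|DL].
    exact: ltn_trans ltD.
  by apply: cL => //; rewrite !inE eqxx.
(* Right to [hi E1], then back across [E1] to [lo E1]; the stretch before [B] is untouched as
   [B <= hi E]. *)
have R1 : reaches n.+1 (lo E1) (fun l => (lo E1 < l < B) || (hi E1 < l)) (E2 :: c ++ L).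
  apply: (@reaches_hop n (hi E) (hi E1) (lo E1) E1 _ _ _ _ ER) => //; try lia.
  - exact: mem_head.
  - by move=> D cD; rewrite /= inE cD orbT.
(* Right from [lo E1] to [lo E2], still before [B], then across [E2] to [hi E2], beyond everything
   walked so far. *)
have R2 : reaches n.+2 (hi E2) (fun l => (lo E2 < l < B) || (hi E2 < l)) (c ++ L).
  apply: (@reaches_hop n.+1 (lo E1) (lo E2) (hi E2) E2 _ _ _ _ R1) => //; try lia.
  - by move=> D cD; apply: okL; rewrite inE cD orbT.
  - exact: mem_head.
  - by move=> D cD; rewrite inE cD orbT.
have [|||D D' cD DL|X cX XR] := IH c E2 n.+2 _ FE2 cLF2 pc _ _ _ R2; try by move: lec => /=; lia.
- by move=> D cD; apply: cB; rewrite !inE cD !orbT.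
- by apply: cL => //; rewrite !inE cD !orbT.
exists X; first by move: cX; rewrite !inE => ->; rewrite !orbT.
by move: XR; rewrite /= !doubleS !addSn !addnS.
Qed.

(* Cut L into successive groups of pairwise crossing ears. Groups at distance
   two are disjoint, so that [nx] gains from the odd ones and [ny] from the
   even ones. *)
Lemma precedes_zigzag (L : seq ear) : {subset L <= F} -> pairwise precedes L ->
  exists nx ny, [/\ size L <= (nx + ny).*2,
    forall n i, (if L is E :: _ then i < lo E else true) ->
      reaches n i (fun l => i < l) L ->
      exists x p, is_path x p /\ n + nx <= #|path_edges x p :&: S|
  & forall n i, (if L is E :: _ then i < hi E else true) ->
      reaches n i (fun l => i < l) L ->
      exists x p, is_path x p /\ n + ny <= #|path_edges x p :&: S|].
Proof.
have [m] := ubnP (size L); elim: m L => // m IH [|E L0] /= ltL LF.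
  by exists 0, 0; split=> // n i _ /reaches_path; rewrite addn0.
case/andP => /allP ELmin pL.
pose P D := lo D < hi E.
pose g := filter P L0; pose L' := filter (predC P) L0.
have szE : size g + size L' = size L0 by rewrite !size_filter count_predC.
have FE : E \in F by apply: LF; exact: mem_head.
have L0F : {subset L0 <= F} by move=> D LD; apply: LF; rewrite inE LD orbT.
have L'F : {subset L' <= F} by move=> D; rewrite mem_filter => /andP[_ /L0F].
have [||nx [ny [szL' xR yR]]] := IH L' _ L'F _; first by lia.
  exact: pairwise_filter.
have [/andP[lohi hiQ] _ _ _ _] := okF FE.
have L'hi D : D \in L' -> hi E <= lo D by rewrite mem_filter /= -leqNgt => /andP[].
have gL D D' : D \in E :: g -> D' \in L' -> precedes D D'.
  move=> gD L'D'; have := L'hi D' L'D'; move: L'D'.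
  rewrite mem_filter => /andP[_ L0D'] EloD'.
  move: gD; rewrite inE => /orP[/eqP->|]; first exact: ELmin.
  rewrite mem_filter => /andP[DE L0D].
  have DD' : D != D' by apply: contraTneq EloD' => <-; rewrite -ltnNge.
  have := pairwise_or pL L0D L0D' DD'.
  case/orP => // /andP[D'D _]; exfalso; move: DE D'D EloD'; rewrite /P; lia.
(* The first group is [E] with [g]: [E] gains 1 and each pair from [g] gains 2. The path then stops
   at a right end, possibly past the left end of the next ear but before its right end, so the rest
   contributes [ny]. Skipping the group instead leaves room to start before the next left end, which
   yields [nx]. *)
exists (1 + (size g)./2.*2 + ny), nx; split.
- by move: szL' szE; have := odd_double_half (size g); lia.
- move=> n i iE iR.
  have iQ : i < size Q by lia.
  have okL : {in E :: L0, forall D, is_ear D} by move=> D /LF; exact: okF.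
  have gL'0 D : D \in g ++ L' -> D \in L0.
    by rewrite mem_cat !mem_filter => /orP[]/andP[].
  have R1 : reaches n.+1 (hi E) (fun l => (lo E < l < hi E) || (hi E < l)) (g ++ L').
    apply: (@reaches_hop n i (lo E) (hi E) E _ _ _ _ iR) => //; try lia.
    - exact: mem_head.
    - by move=> D /gL'0 LD; rewrite inE LD orbT.
    - apply: disF_lo => // [D /gL'0 /L0F //|D /gL'0 /ELmin /andP[] //].
  have [|||D D' gD|X gX XR] := crossing_zigzag FE _ _ (leqnn (hi E)) _ _ R1.
  - by move=> D /gL'0 /L0F.
  - rewrite path_sortedE; last exact: precedes_trans.
    apply/andP; split; first by apply/allP => D; rewrite mem_filter => /andP[_ /ELmin].
    by rewrite sorted_pairwise ?pairwise_filter //; exact: precedes_trans.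
  - by move=> D; rewrite mem_filter => /andP[].
  - by move=> /(gL D) gD'; have /andP[] := gD' (mem_behead (s := E :: g) gD).
  have [|x [p [pP pS]]] := yR _ _ _ XR.
    by move: (gL X) => /(_ _ gX); case: (L') => // D L1 /(_ D (mem_head _ _)) /andP[].
  by exists x, p; split=> //; rewrite !addnA addn1.
- move=> n i iE iR.
  apply: (xR n i).
    by move: L'hi; case: (L') => // D L1 /(_ D (mem_head _ _)); exact: leq_trans.
  apply: reaches_sub iR _ _ => // D; rewrite mem_filter => /andP[_ LD].
  by rewrite inE LD orbT.
Qed.

Hypothesis uniqF : uniq F.
Hypothesis endsF : {in F &, forall E E', E != E' -> uniq [:: lo E; hi E; lo E'; hi E']}.
Hypothesis loF : {in F, forall E, 0 < lo E}.

Lemma zigzag k : 4 * k ^ 2 < size F ->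
  exists x p, is_path x p /\ k < #|path_edges x p :&: S|.
Proof.
move=> szF.
have [|[c [szc Rc cF]]|[M [szM subM nR]]] :=
  @exists_chain_or_antichain _ nested k (4 * k) F; first by rewrite mulnCA mulnn.
  case: c szc Rc cF => // E c [szc] Ec cF.
  have FE : E \in F by apply: cF; exact: mem_head.
  have cF' : {subset c <= F} by move=> D cD; apply: cF; rewrite inE cD orbT.
  have [/andP[lohi hiQ] _ _ _ _] := okF FE.
  have okc : {in E :: c, forall D, is_ear D} by move=> D /cF; exact: okF.
  have loQ := ltn_trans lohi hiQ.
  (* Start at the left end of the outermost ear and cross it, which gives the first edge. *)
  rewrite -szc -add1n; apply: (nested_zigzag (i := hi E) FE cF' Ec).
    by rewrite eqxx orbT.
  apply: (@reaches_hop 0 (lo E) (lo E) (hi E) E _ _ _ _ (reaches_start loQ okc)) => //=; try lia.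
  - exact: mem_head.
  - by move=> D cD; rewrite inE cD orbT.
  - by apply: disF_lo => // D; move: (order_path_min nested_trans Ec) => /allP /[apply] /andP[].
have MF : {subset M <= F} by exact: mem_subseq.
pose L := sort (relpre lo leq) M.
have LM : L =i M by exact: mem_sort.
have LF : {subset L <= F} by move=> E; rewrite LM => /MF.
(* Once sorted by left ends, which are distinct, ears that are not nested have their right ends in
   the same order. *)
have pL : pairwise precedes L.
  have tot : total (relpre lo leq) by move=> E E'; exact: leq_total.
  have tr : transitive (relpre lo leq) by move=> ? ? ?; exact: leq_trans.
  have : pairwise [rel E E' | (lo E <= lo E') && (E != E')] L.
    rewrite pairwise_relI -sorted_pairwise // sort_sorted //=.
    by rewrite -uniq_pairwise sort_uniq (subseq_uniq subM).
  apply: (@sub_in_pairwise _ [in M]); last by apply/allP => E; rewrite LM.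
  move=> E E' ME ME' /= /andP[le ne].
  have := endsF (MF _ ME) (MF _ ME') ne; have := nR _ _ ME ME'.
  by rewrite /nested /precedes /= !inE; clear -le; lia.
have [nx [ny [szL xR yR]]] := precedes_zigzag LF pL.
have R0 : reaches 0 0 (fun l => 0 < l) L.
  have R0 := @reaches_start 0 L (ltn0Sn _) (fun E LE => okF (LF _ LE)).
  by apply: reaches_sub R0 _ _ => // -[].
(* More than [4 * k] ears and at most [2 * (nx + ny)] of them force [nx] or [ny] above [k]. *)
have [kx|kx] := ltnP k nx.
  have [|x [p [pP pS]]] := xR 0 0 _ R0.
    by case: (L) LF => // E L1 /(_ E (mem_head _ _)) /loF.
  by exists x, p; split=> //; lia.
have [|x [p [pP pS]]] := yR 0 0 _ R0.
  case: (L) LF => // E L1 /(_ E (mem_head _ _)) /okF[/andP[+ _] _ _ _ _].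
  exact: leq_ltn_trans.
exists x, p; split=> //; apply: leq_trans pS; rewrite add0n.
by move: szL; rewrite size_sort => /(leq_trans szM); move: kx; clear; lia.
Qed.
End Zigzag.

(** * The ears of the heavy branch *)

Section Assembly.
Variables (G : sgraph) (S : {set {set G}}) (x0 : G) (p0 : seq G).
Hypothesis cubic : subcubic G.
Hypothesis p0P : is_path x0 p0.
Let Q := x0 :: p0.
Let q i := nth x0 Q i.
Notation ear := (nat * nat * seq G)%type.

Lemma ear_of_path s d t :
    s \in Q -> t \in Q -> s != t -> path (@adj G) s (rcons d t) -> uniq d ->
    {in d, forall v, v \notin Q} -> path_edges s (rcons d t) :&: S != set0 ->
  exists E : ear, [/\ is_ear S x0 p0 E, mid E =i d & [set q (lo E); q (hi E)] = [set s; t]].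
Proof.
move=> sQ tQ st dP dU dQ dS.
have iQ : index s Q < size Q by rewrite index_mem.
have jQ : index t Q < size Q by rewrite index_mem.
have qi : q (index s Q) = s by exact: nth_index.
have qj : q (index t Q) = t by exact: nth_index.
have [ij|ji|ij] := ltngtP (index s Q) (index t Q).
- exists (index s Q, index t Q, d).
  by rewrite /is_ear /lo /hi /mid /= -/Q -/(q _) -/(q _) ?ij ?jQ qi qj.
- exists (index t Q, index s Q, rev d).
  rewrite /is_ear /lo /hi /mid /= -/Q -/(q _) -/(q _) ?ji ?iQ qi qj setUC !rev_ear rev_uniq.
  split=> //; last by move=> v; rewrite mem_rev.
  by split=> // v; rewrite mem_rev => /dQ.
- by rewrite -qi ij qj eqxx in st.
Qed.

(** Take an ear through an edge of [S] with an end [z] in [D]. As [z] is not on [Q], it is an inner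
    vertex, so the interior is nonempty. *)
Lemma exists_ear_in_set (D : {set G}) :
    S \subset edges G -> k_connected 2 G -> 1 < size Q -> {in D, forall z, z \notin Q} ->
    closed_off Q D -> touching S D != set0 ->
  exists E : ear, [/\ is_ear S x0 p0 E, mid E != [::] & {subset mid E <= D}].
Proof.
move=> SE conn2 Q2 DQ Dcl /set0Pn[e /touchingP[eS [z ez Dz]]].
have [w zw eE] := edge_at SE eS ez.
have dis : [disjoint [set v in Q] & D].
  by apply/pred0P => v /=; rewrite inE; apply/negP => /andP[vQ /DQ]; rewrite vQ.
have cl u v : u \in D -> adj u v -> (v \in D) || (v \in [set v in Q]).
  by rewrite [v \in [set _ in _]]inE; exact: Dcl.
have cardQ : 1 < #|[set v in Q]|.
  by rewrite cardsE (card_uniqP _) //; case: p0P.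
have [s [d [t [[/andP[sQ tQ] st dP dU dD] ed]]]] :=
  exists_ear_through_edge conn2 dis cl cardQ Dz zw.
rewrite -eE in ed; rewrite inE in sQ; rewrite inE in tQ.
have [||E [okE Ed _]] := @ear_of_path s d t sQ tQ st dP dU.
- by move=> v /dD /DQ.
- by apply/set0Pn; exists e; rewrite in_setI ed.
exists E; split=> //; last by move=> v; rewrite Ed => /dD.
have zd : z \in d.
  have := path_edges_sub ed ez; rewrite inE mem_rcons inE => /or3P[/eqP zs|/eqP zt|//].
    by have := DQ z Dz; rewrite zs sQ.
  by have := DQ z Dz; rewrite zt tQ.
by apply: contraTneq zd => E0; rewrite -Ed E0.
Qed.

Lemma mem_path_edges_nth i : i.+1 < size Q -> [set q i; q i.+1] \in path_edges x0 p0.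
Proof.
move=> iQ; rewrite inE -(nth_pairmap x0 set0 (fun u v : G => [set u; v])) //.
by apply: mem_nth; rewrite size_pairmap.
Qed.

Lemma exists_chord_ear e :
    S \subset edges G -> e \in inside S Q -> e \notin path_edges x0 p0 ->
  exists E : ear, [/\ is_ear S x0 p0 E, mid E = [::], (lo E).+1 < hi E
    & [set q (lo E); q (hi E)] = e].
Proof.
move=> SE; rewrite inE => /andP[eS eQ] ne.
have := subsetP SE e eS; rewrite inE => /existsP[u /existsP[v /andP[uv /eqP eE]]].
have uQ : u \in Q by apply: (subsetP eQ); rewrite eE !inE eqxx.
have vQ : v \in Q by apply: (subsetP eQ); rewrite eE !inE eqxx orbT.
have nuv : u != v by apply: contraTneq uv => ->; rewrite adj_irrefl.
have [|//|//||E [okE Ed Euv]] := @ear_of_path u [::] v uQ vQ nuv.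
- by rewrite /= uv.
- by apply/set0Pn; exists e; rewrite in_setI eS eE path_edges_cons inE set11.
have Ed0 : mid E = [::] by case: (mid E) Ed => // y s /(_ y); rewrite inE eqxx.
exists E; split=> //; last by rewrite Euv.
have [/andP[lohi hiQ] _ _ _ _] := okE.
rewrite ltn_neqAle lohi andbT; apply: contra ne => /eqP hiE.
by rewrite eE -Euv -hiE mem_path_edges_nth // hiE.
Qed.

(** * Distinct ends from the degree bound *)

Variable F : seq ear.
Hypothesis okF : {in F, forall E, is_ear S x0 p0 E}.
Hypothesis disF : {in F &, forall E E', E != E' -> {in mid E, forall v, v \notin mid E'}}.
Hypothesis uniqF : uniq F.
Hypothesis chordF : {in F, forall E, mid E = [::] -> (lo E).+1 < hi E}.

Definition ends_at i (E : ear) := (lo E == i) || (hi E == i).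
(** The neighbour of [q i] along the ear; the default value, the opposite end, serves chords. *)
Definition first_step i (E : ear) :=
  if lo E == i then head (q (hi E)) (mid E) else last (q (lo E)) (mid E).

Lemma adj_first_step i E : E \in F -> ends_at i E -> adj (q i) (first_step i E).
Proof.
rewrite /ends_at /first_step => /okF[_ + _ _ _]; rewrite -/Q -/(q _) -/(q _).
case: eqP => [-> eP _|_ eP /= /eqP <-].
  by case: (mid E) eP => [|y d] /= /andP[].
by move: eP; rewrite rcons_path adj_sym => /andP[].
Qed.

Lemma first_step_mid i E : mid E != [::] -> first_step i E \in mid E.
Proof.
rewrite /first_step; case: ifP => _; first by case: (mid E) => //= y d _; exact: mem_head.
by case: (mid E) => //= y d _; exact: mem_last.
Qed.

Lemma first_step_chord i E : E \in F -> ends_at i E -> mid E = [::] ->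
  exists j, [/\ first_step i E = q j, j < size Q,
    (lo E == i) && (hi E == j) || (lo E == j) && (hi E == i) & (i.+1 < j) || (j.+1 < i)].
Proof.
move=> FE iE E0; have := chordF FE E0; have [/andP[lohi hiQ] _ _ _ _] := okF FE.
move: iE; rewrite /ends_at /first_step E0 /=; case: eqP => [iE _|iE /= /eqP iE'] lt.
  by exists (hi E); split=> //; rewrite ?eqxx; lia.
by exists (lo E); split=> //; rewrite ?(ltn_trans lohi hiQ) //; lia.
Qed.

(** Disjoint interiors separate two ears with inner vertices, a chord steps onto [Q] and any other
    ear off it, and two chords at [i] with the same far end coincide. *)
Lemma first_step_inj i : {in [seq E <- F | ends_at i E] &, injective (first_step i)}.
Proof.
move=> E E'; rewrite !mem_filter => /andP[iE FE] /andP[iE' FE'] eqf.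
apply/eqP; apply: contraT => ne.
have [_ _ _ EQ _] := okF FE; have [_ _ _ EQ' _] := okF FE'.
have [E0|/(first_step_mid i) fE] := eqVneq (mid E) [::];
have [E0'|/(first_step_mid i) fE'] := eqVneq (mid E') [::].
- have [j [fj jQ jE _]] := first_step_chord FE iE E0.
  have [j' [fj' jQ' jE' _]] := first_step_chord FE' iE' E0'.
  move: eqf; rewrite fj fj' => /eqP; rewrite (q_inj p0P jQ jQ') => /eqP jj'.
  have [/andP[lohi _] _ _ _ _] := okF FE; have [/andP[lohi' _] _ _ _ _] := okF FE'.
  case/negP: ne; apply/eqP; move: E0 E0' jE jE' lohi lohi'; rewrite -jj'; clear.
  case: E => [[a b] d]; case: E' => [[a' b'] d']; rewrite /mid /lo /hi /= => -> -> *.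
  by congr (_, _, _); lia.
- have [j [fj jQ _ _]] := first_step_chord FE iE E0.
  by have := EQ' _ fE'; rewrite -eqf fj mem_nth.
- have [j [fj jQ _ _]] := first_step_chord FE' iE' E0'.
  by have := EQ _ fE; rewrite eqf fj mem_nth.
- by have := disF FE FE' ne fE; rewrite eqf fE'.
Qed.

(** The first steps of the ears at [i] and the neighbours of [q i] on [Q] listed by [ns] are
    distinct neighbours of [q i]; chords never join consecutive positions. So at most one ear ends
    at an inner position of [Q], and at most two at either end. *)
Lemma count_ends_at i (ns : seq nat) :
    i < size Q -> uniq ns ->
    {in ns, forall n, (n < size Q) && ((n.+1 == i) || (n == i.+1))} ->
  size [seq E <- F | ends_at i E] + size ns <= 3.
Proof.
move=> iQ uns nsP; apply: leq_trans (cubic (q i)).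
have nbr : {subset map (first_step i) [seq E <- F | ends_at i E] ++ map q ns
             <= enum [set y | adj (q i) y]}.
  move=> y; rewrite mem_enum inE mem_cat => /orP[]/mapP[].
    by move=> E; rewrite mem_filter => /andP[iE FE] ->; exact: adj_first_step.
  move=> n /nsP /andP[nQ /orP[]/eqP E] ->.
    by rewrite adj_sym -E; apply: (adj_q p0P); rewrite E.
  by rewrite E; apply: (adj_q p0P); rewrite -E.
rewrite /degree cardE -(size_map (first_step i)) -[size ns](size_map q) -size_cat.
apply: uniq_leq_size nbr; rewrite cat_uniq; apply/and3P; split.
- by rewrite map_inj_in_uniq ?filter_uniq //; exact: first_step_inj.
- apply/hasPn => _ /mapP[n nsn ->]; apply/negP => /mapP[E].
  have /andP[nQ ni] := nsP n nsn.
  rewrite mem_filter => /andP[iE FE] qE.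
  have [E0|/(first_step_mid i)] := eqVneq (mid E) [::].
    have [j [fj jQ _ jn]] := first_step_chord FE iE E0.
    by move: qE; rewrite fj => /eqP; rewrite (q_inj p0P nQ jQ); lia.
  by have [_ _ _ EQ _] := okF FE => /EQ; rewrite -qE mem_nth.
- rewrite map_inj_in_uniq // => n n' /nsP/andP[nQ _] /nsP/andP[nQ' _] /eqP.
  by rewrite (q_inj p0P nQ nQ') => /eqP.
Qed.

(** The summand 4 pays for discarding the ears at the two ends of [Q]; the others have distinct ends
    and start after position 0. *)
Lemma exists_path_of_ears k : 1 < size Q -> 4 * k ^ 2 + 4 < size F ->
  exists x p, is_path x p /\ k < #|path_edges x p :&: S|.
Proof.
move=> Q2 szF; pose m := (size Q).-1.
have mE : size Q = m.+1 by [].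
pose bad E := ends_at 0 E || ends_at m E.
pose F' := [seq E <- F | ~~ bad E].
have c0 : size [seq E <- F | ends_at 0 E] + 1 <= 3.
  by apply: (@count_ends_at 0 [:: 1]) => // n; rewrite inE => /eqP->; rewrite eqxx orbT andbT.
have cm : size [seq E <- F | ends_at m E] + 1 <= 3.
  apply: (@count_ends_at m [:: m.-1]) => // n.
  by rewrite inE => /eqP->; lia.
have szF' : 4 * k ^ 2 < size F'.
  have szE : count bad F + size F' = size F by rewrite size_filter -(count_predC bad F).
  have le4 : count bad F <= 2 + 2.
    apply: (@leq_trans (count (ends_at 0) F + count (ends_at m) F)).
      by rewrite -count_predUI leq_addr.
    by rewrite !size_filter !addn1 !ltnS in c0 cm; exact: leq_add.
  by rewrite -(ltn_add2r 4) (leq_trans szF) // -szE addnC leq_add2l.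
have F'F : {subset F' <= F} by exact/mem_subseq/filter_subseq.
apply: (@zigzag G S x0 p0 p0P F') => //.
- by move=> E /F'F; exact: okF.
- by move=> E E' /F'F FE /F'F; exact: disF.
- exact: filter_uniq.
- move=> E E'; rewrite !mem_filter => /andP[bE FE] /andP[bE' FE'] ne.
  have [/andP[lohi hiQ] _ _ _ _] := okF FE.
  have [/andP[lohi' hiQ'] _ _ _ _] := okF FE'.
  have noshare i : 0 < i -> i < m -> ends_at i E -> ends_at i E' -> False.
    move=> i0 im iE iE'.
    have le2 : 2 <= size [seq E <- F | ends_at i E].
      apply: (@uniq_leq_size _ [:: E; E']); first by rewrite /= inE ne.
      by move=> D; rewrite !inE mem_filter => /orP[]/eqP->; rewrite ?iE ?iE'.
    have iQ : i < size Q by rewrite mE ltnS ltnW.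
    have : size [seq E <- F | ends_at i E] + 2 <= 3.
      apply: (@count_ends_at i [:: i.-1; i.+1]) => //; first by rewrite /= inE andbT; lia.
      by move=> n; rewrite !inE => /orP[]/eqP->; rewrite mE; lia.
    by move/(leq_trans (leq_add le2 (leqnn 2))).
  have nlo := noshare (lo E); have nhi := noshare (hi E).
  move: nlo nhi bE bE' lohi hiQ lohi' hiQ'.
  rewrite /bad /ends_at mE /= !inE !eqxx /= ?orbT; clear; lia.
- move=> E; rewrite mem_filter => /andP[+ _]; rewrite /bad /ends_at; clear; lia.
Qed.

End Assembly.

(** * Final count and conclusion *)

(** Here [d] counts components left behind, [i'] the edges of [S] with both ends on the branch, [r]
    those on the branch itself and [c] the chords. Passing from [k.+1] to [k] frees [8 * k + 4],
    enough for the at most [k] edges in [r] and the 4 ears to be discarded. *)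
Lemma few_exceptions k d i i' r c :
    i' <= r + c -> 4 * k.+1 ^ 2 < d + i -> i <= i' -> r < k.+1 ->
  4 * k ^ 2 + 4 < d + c.
Proof. by rewrite -!mulnn; lia. Qed.

Theorem theorem3p2 (G : sgraph) (S : {set {set G}}) (k : nat)
    (conn2 : k_connected 2 G) (cubic : subcubic G)
    (SE : S \subset edges G) (largeS : 2 ^ (4 * k ^ 2) <= #|S|) :
  exists (x : G) (p : seq G),
    is_path x p /\ k <= #|path_edges x p :&: S|.
Proof.
have [x0 _] : exists x0, x0 \in G by apply/card_gt0P; apply: leq_trans conn2.1.
have x0P : is_path x0 [::] by [].
case: k largeS => [|k] largeS; first by exists x0, [::].
have [h hx] : exists h, h != x0.
  have : 0 < #|[set~ x0]| by rewrite cardsC1; case: #|G| conn2.1 => [|[]].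
  by case/card_gt0P => h; rewrite !inE; exists h.
have [w xw] : exists w, adj x0 w.
  have := conn2.2 set0; rewrite cards0 => /(_ isT) /(_ x0 h).
  rewrite !inE => /(_ isT isT) /connectP[[|w p] /=]; first by move=> _ hE; rewrite hE eqxx in hx.
  by move=> /andP[/and3P[_ _ xw] _] _; exists w.
have wx : w != x0 by apply: contraTneq xw => ->; rewrite adj_irrefl.
pose C := [set~ x0].
(* Every edge has an end other than [x0], so all of [S] is counted at the start of the branch. *)
have touchC : touching S C = S.
  apply/setP => e; apply/touchingP/idP => [[]//|eS]; split=> //.
  have := subsetP SE e eS; rewrite inE => /existsP[u /existsP[v /andP[uv /eqP->]]].
  have [ux|ux] := eqVneq u x0; last by exists u; rewrite !inE ?eqxx.
  exists v; rewrite !inE ?eqxx ?orbT //; apply: contraTneq uv => ->.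
  by rewrite ux adj_irrefl.
have [||||p' [Ds [p'P p'0 _ [dDs DsP] cnt]]] :=
  @heavy_branch G cubic S SE C x0 [::] w x0P _ _ _ xw _.
- by move=> z; rewrite !inE.
- by move=> u v _ _; rewrite !inE orNb.
- by rewrite !inE.
- have := conn2.2 [set x0]; rewrite cards1 => /(_ isT) conn z zC.
  by apply: conn; rewrite // !inE.
rewrite /= in p'P cnt; rewrite touchC in cnt.
have [kp|kp] := leqP k.+1 #|path_edges x0 p' :&: S|; first by exists x0, p'.
have Q2 : 1 < size (x0 :: p') by case: (p') p'0.
pose chords := inside S (x0 :: p') :\: path_edges x0 p'.
(* Outside [Ds] a dummy triple is supplied, so that ears can be chosen by a total function; likewise
   for chords. *)
have earD D : exists E : nat * nat * seq G, D \in Ds ->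
    [/\ is_ear S x0 p' E, mid E != [::] & {subset mid E <= D}].
  have [/DsP[DC Dp Dcl Dt]|] := boolP (D \in Ds); last by exists (0, 0, [::]).
  have [|E EP] := @exists_ear_in_set G S x0 p' p'P D SE conn2 Q2 _ Dcl Dt; last by exists E.
  move=> z Dz; rewrite inE negb_or Dp // andbT.
  by have := subsetP DC z Dz; rewrite !inE.
have earC e : exists E : nat * nat * seq G, e \in chords ->
    [/\ is_ear S x0 p' E, mid E = [::], (lo E).+1 < hi E
      & [set nth x0 (x0 :: p') (lo E); nth x0 (x0 :: p') (hi E)] = e].
  have [|] := boolP (e \in chords); last by exists (0, 0, [::]).
  rewrite in_setD => /andP[ne ei]; have [E EP] := exists_chord_ear SE ei ne.
  by exists E.
have [f fP] := fin_all_exists earD; have [g gP] := fin_all_exists earC.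
pose F := map f Ds ++ map g (enum chords).
have DsI : {in Ds &, forall D D' : {set G}, D != D' -> [disjoint D & D']}.
  move=> D D' DD DD' ne; have := pairwise_or dDs DD DD' ne.
  by rewrite [[disjoint D' & D]]disjoint_sym orbb.
have f_inj : {in Ds &, injective f}.
  move=> D D' DD DD' ff; apply/eqP; apply: contraT => ne.
  have [_ m0 sub] := fP D DD; have [_ _ sub'] := fP D' DD'.
  case E: (mid (f D)) m0 => [//|y d] _.
  have yD : y \in D by apply: sub; rewrite E mem_head.
  have yD' : y \in D' by apply: sub'; rewrite -ff E mem_head.
  by have := disjointFr (DsI _ _ DD DD' ne) yD; rewrite yD'.
have g_inj : {in enum chords &, injective g}.
  move=> e e'; rewrite !mem_enum => /gP[_ _ _ Ee] /gP[_ _ _ Ee'] gg.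
  by rewrite -Ee -Ee' gg.
(* The members of [Ds] touch edges of [S], so they are nonempty, and disjoint members are
   distinct. *)
have uDs : uniq Ds.
  rewrite uniq_pairwise; apply: (@sub_in_pairwise _ [in Ds] _ _ _ Ds _ dDs).
    move=> D D' /DsP[_ _ _ /set0Pn[e /touchingP[_ [z _ zD]]]] _ dis.
    by apply: contraTneq dis => <-; apply/pred0Pn; exists z; rewrite /= zD.
  by apply/allP.
have FP E : E \in F -> (exists2 D, D \in Ds & E = f D) \/ (exists2 e, e \in chords & E = g e).
  rewrite mem_cat => /orP[/mapP[D DD ->]|/mapP[e ec ->]]; first by left; exists D.
  by right; exists e; rewrite // -mem_enum.
have szF : 4 * k ^ 2 + 4 < size F.
  rewrite size_cat !size_map -cardE.
  have sz : #|inside S (x0 :: p')| <= #|path_edges x0 p' :&: S| + #|chords|.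
    rewrite -(cardsID (path_edges x0 p') (inside _ _)) leq_add2r subset_leq_card //.
    by apply/subsetP => e; rewrite !in_setI !inE => /andP[/andP[-> _] ->].
  have := leq_ltn_trans largeS cnt; rewrite ltn_exp2l // => lt.
  have le : #|S :&: inside S (x0 :: p')| <= #|inside S (x0 :: p')|.
    by rewrite subset_leq_card // subsetIr.
  exact: few_exceptions sz lt le kp.
apply: (exists_path_of_ears cubic p'P _ _ _ _ Q2 szF).
- by move=> E /FP[[D /fP[? _ _] ->]|[e /gP[? _ _ _] ->]].
- move=> E E' /FP[[D DD ->]|[e /gP[_ E0 _ _] ->]]; last by rewrite E0.
  move=> /FP[[D' DD' ->]|[e /gP[_ E0 _ _] ->]] ne v; last by rewrite E0.
  have [_ _ sub] := fP D DD; have [_ _ sub'] := fP D' DD' => /sub vD.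
  have DD'ne : D != D' by apply: contraNneq ne => ->.
  by apply/negP => /sub'; rewrite (disjointFr (DsI _ _ DD DD' DD'ne) vD).
(* Ears from components have nonempty interiors and chords empty ones, so the two lists share no
   ear. *)
- rewrite cat_uniq !map_inj_in_uniq // uDs enum_uniq andbT /=.
  apply/hasPn => _ /mapP[e + ->]; rewrite mem_enum => /gP[_ E0 _ _].
  by apply/negP => /mapP[D /fP[_ + _] gf]; rewrite -gf E0.
- by move=> E /FP[[D /fP[_ + _] -> E0]|[e /gP[_ _ + _] ->]//]; rewrite E0.
Qed.
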